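(* Let $\psi$ be a unit speed slant helix in $E^3$ with curvature $\kappa$, whose principal normal vector makes the constant angle $\phi$ with a fixed straight line (the axis of the slant helix); put $n=\cos\phi$, assume $0<|n|<1$, and let $m=\dfrac{n}{\sqrt{1-n^2}}$. Then, in a suitable rectangular coordinate system of $E^3$ (i.e. up to an isometry of $E^3$) and for suitable choices of the constants of integration, the position vector $\psi=(\psi_1,\psi_2,\psi_3)$ is given in the natural representation (arc length $s$) by $$\begin{cases} \psi_1(s)=\dfrac{n}{m}\displaystyle\int\left[\int\kappa(s)\cos\Big[\tfrac{1}{n}\arcsin\Big(m\int\kappa(s)\,ds\Big)\Big]ds\right]ds,\\[2mm] \psi_2(s)=\dfrac{n}{m}\displaystyle\int\left[\int\kappa(s)\sin\Big[\tfrac{1}{n}\arcsin\Big(m\int\kappa(s)\,ds\Big)\Big]ds\right]ds,\\[2mm] \psi_3(s)=n\displaystyle\int\Big[\int\kappa(s)\,ds\Big]ds, \end{cases}$$ or, in terms of the parameter $\theta=\int\kappa(s)\,ds$, by $$\begin{cases} \psi_1(\theta)=\dfrac{n}{m}\displaystyle\int\frac{1}{\kappa(\theta)}\left[\int\cos\Big[\tfrac{1}{n}\arcsin(m\theta)\Big]d\theta\right]d\theta,\\[2mm] \psi_2(\theta)=\dfrac{n}{m}\displaystyle\int\frac{1}{\kappa(\theta)}\left[\int\sin\Big[\tfrac{1}{n}\arcsin(m\theta)\Big]d\theta\right]d\theta,\\[2mm] \psi_3(\theta)=n\displaystyle\int\frac{\theta}{\kappa(\theta)}\,d\theta, \end{cases}$$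 or, in terms of the parameter $t=\frac{1}{n}\arcsin(m\theta)$, by $$\begin{cases} \psi_1(t)=\dfrac{n^3}{m^3}\displaystyle\int\frac{\cos(nt)}{\kappa(t)}\left[\int\cos(t)\cos(nt)\,dt\right]dt,\\[2mm] \psi_2(t)=\dfrac{n^3}{m^3}\displaystyle\int\frac{\cos(nt)}{\kappa(t)}\left[\int\sin(t)\cos(nt)\,dt\right]dt,\\[2mm] \psi_3(t)=\dfrac{n^2}{m^2}\displaystyle\int\frac{\sin(nt)\cos(nt)}{\kappa(t)}\,dt. \end{cases}$$
   Context: $E^3$ is $\mathbb{R}^3$ with the usual metric. Curves are defined on an interval, have at least four continuous derivatives, and have nonvanishing curvature $\kappa>0$; $\mathbf{N}$ denotes the principal normal of the Frenet frame. A slant helix is a curve whose principal normal vector makes a constant angle with a fixed straight line, i.e. there is a constant unit vector $\mathbf{d}$ (direction of the axis) with $\langle\mathbf{N},\mathbf{d}\rangle=n=\cos\phi$ along the curve. All integrals are indefinite integrals (antiderivatives). The antiderivative $\theta=\int\kappa(s)\,ds$ is the same wherever it occurs, and its integration constant is among those to be chosen suitably; in particular $|m\theta|<1$ along the curve. $\kappa(\theta)$ and $\kappa(t)$ denote the curvature expressed in the parameters $\theta$ and $t$. Isometries of $E^3$ may be orientation preserving or reversing. *)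

(* Defs.v *)
From Stdlib Require Export Reals.
Open Scope R_scope.

Record E3 : Type := mkE3 { x1 : R; x2 : R; x3 : R }.

Definition dot (p q : E3) : R := x1 p * x1 q + x2 p * x2 q + x3 p * x3 q.
Definition scal (a : R) (p : E3) : E3 := mkE3 (a * x1 p) (a * x2 p) (a * x3 p).
Definition norm (p : E3) : R := sqrt (dot p p).
Definition dist3 (p q : E3) : R :=
  norm (mkE3 (x1 p - x1 q) (x2 p - x2 q) (x3 p - x3 q)).

Definition isometry (F : E3 -> E3) : Prop :=
  forall p q : E3, dist3 (F p) (F q) = dist3 p q.

(* Open, half-open, closed, bounded or not; at least two points, since the
   relative derivative [D_in] is meaningless at an isolated point. *)
Definition is_interval (J : R -> Prop) : Prop :=
  (forall x y z, J x -> J y -> x <= z <= y -> J z) /\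
  (exists x y, J x /\ J y /\ x < y).

(* Derivatives are relative to J, hence one-sided at an endpoint in J. *)
Definition deriv_on (J : R -> Prop) (f f' : R -> R) : Prop :=
  forall x, J x -> D_in f f' J x.

(* An indefinite integral: [antideriv J f F] reads "F is one of the functions
   denoted by the integral of f on J". *)
Definition antideriv (J : R -> Prop) (f F : R -> R) : Prop := deriv_on J F f.

Fixpoint class_C (k : nat) (J : R -> Prop) (f : R -> R) : Prop :=
  match k with
  | O => forall x, J x -> continue_in f J x
  | S k' => exists f', deriv_on J f f' /\ class_C k' J f'
  end.

Definition curve_C (k : nat) (J : R -> Prop) (c : R -> E3) : Prop :=
  class_C k J (fun s => x1 (c s)) /\
  class_C k J (fun s => x2 (c s)) /\
  class_C k J (fun s => x3 (c s)).

Definition vderiv_on (J : R -> Prop) (c c' : R -> E3) : Prop :=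
  deriv_on J (fun s => x1 (c s)) (fun s => x1 (c' s)) /\
  deriv_on J (fun s => x2 (c s)) (fun s => x2 (c' s)) /\
  deriv_on J (fun s => x3 (c s)) (fun s => x3 (c' s)).

Definition unit_speed (J : R -> Prop) (psi : R -> E3) : Prop :=
  exists T, vderiv_on J psi T /\ forall s, J s -> norm (T s) = 1.

(* For a unit speed curve: kappa = |T'| > 0 and N = T' / kappa, T = psi'. *)
Definition curvature_normal (J : R -> Prop) (psi : R -> E3)
    (kappa : R -> R) (N : R -> E3) : Prop :=
  exists T T', vderiv_on J psi T /\ vderiv_on J T T' /\
    forall s, J s ->
      kappa s = norm (T' s) /\ 0 < kappa s /\ N s = scal (/ kappa s) (T' s).

(* The principal normal N makes the constant angle phi with a fixed line, of
   unit direction d. *)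
Definition slant (J : R -> Prop) (N : R -> E3) (phi : R) : Prop :=
  exists d, norm d = 1 /\ forall s, J s -> dot (N s) d = cos phi.

(* On J the map p is injective, with inverse q on the image of J: a function f
   of the old parameter becomes [fun u => f (q u)] in the parameter u = p s. *)
Definition reparam (J : R -> Prop) (p q : R -> R) : Prop :=
  forall s, J s -> q (p s) = s.

(* Main.v *)
(* Let [T], [N] be the tangent and the normal and [d] the axis. Since
   [<T, d>' = kappa <N, d> = n kappa], the function [theta = <T, d> / n] is an
   antiderivative of the curvature. The projection of [N] on the plane
   orthogonal to [d] has constant length [r = sqrt (1 - n^2) = n / m], so it
   rotates, with some angular velocity [w]; differentiating [<T, N> = 0] gives
   [w b = kappa], where [b] is the component of the binormal along [d] and
   [b^2 = 1 - n^2 - n^2 theta^2]. Hence [b] never vanishes, which is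
   [|m theta| < 1] (also at the endpoints of the interval), it has a constant
   sign, and [w] is, up to that sign, the derivative of
   [t = (1 / n) arcsin (m theta)]. Up to a plane isometry the projected normal
   is therefore [r (cos t, sin t)]; integrating [psi'' = kappa N] twice gives
   the natural representation, and the others follow by the change of
   variable [theta' = kappa], [t' = kappa / (r cos (n t))]. *)

From Coquelicot Require Import Coquelicot.
Require Import Defs.
From Stdlib Require Import Reals Lra Classical ClassicalEpsilon.
Open Scope R_scope.

(** * Differentiation rules relative to a set *)

(** [D_in] reads its second argument only at [x], so a constant function can carry the value [l],
    which then becomes open to rewriting. *)
Definition deriv_at (J : R -> Prop) (f : R -> R) (l x : R) : Prop :=
  D_in f (fun _ => l) J x.

Lemma deriv_onE (J : R -> Prop) (f f' : R -> R) (x : R) :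
  deriv_on J f f' -> J x -> deriv_at J f (f' x) x.
Proof. intros H Hx; exact (H x Hx). Qed.

Lemma deriv_at_ext (J : R -> Prop) (f g : R -> R) (l l' x : R) :
  (forall s, J s -> f s = g s) -> l = l' -> J x ->
  deriv_at J f l x -> deriv_at J g l' x.
Proof.
intros Hfg -> Hx H.
apply limit1_ext with (2 := H).
intros s [Hs _]; rewrite !Hfg; auto.
Qed.

Lemma deriv_at_const (J : R -> Prop) (c x : R) : deriv_at J (fun _ => c) 0 x.
Proof. exact (Dconst J c x). Qed.

Lemma deriv_at_plus (J : R -> Prop) (f g : R -> R) (l k x : R) :
  deriv_at J f l x -> deriv_at J g k x ->
  deriv_at J (fun s => f s + g s) (l + k) x.
Proof. exact (Dadd J (fun _ => l) (fun _ => k) f g x). Qed.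

Lemma deriv_at_mult (J : R -> Prop) (f g : R -> R) (l k x : R) :
  deriv_at J f l x -> deriv_at J g k x ->
  deriv_at J (fun s => f s * g s) (l * g x + f x * k) x.
Proof. exact (Dmult J (fun _ => l) (fun _ => k) f g x). Qed.

Lemma deriv_at_scal (J : R -> Prop) (a : R) (f : R -> R) (l x : R) :
  deriv_at J f l x -> deriv_at J (fun s => a * f s) (a * l) x.
Proof. exact (Dmult_const J f (fun _ => l) x a). Qed.

Lemma deriv_at_comp (J : R -> Prop) (f g : R -> R) (l k x : R) :
  deriv_at J f l x -> is_derive g (f x) k ->
  deriv_at J (fun s => g (f s)) (l * k) x.
Proof.
intros Hf Hg%is_derive_Reals.
assert (Hg' : D_in g (fun _ => k) no_cond (f x)).
{ apply derivable_pt_lim_D_in; exact Hg. }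
apply limit1_imp with
  (2 := Dcomp J no_cond (fun _ => l) (fun _ => k) f g x Hf Hg').
intros s [Hs Hne]; repeat split; auto.
Qed.

Lemma deriv_at_div (J : R -> Prop) (f g : R -> R) (l k x : R) :
  deriv_at J f l x -> deriv_at J g k x -> g x <> 0 -> J x ->
  deriv_at J (fun s => f s / g s) ((l * g x - f x * k) / g x ^ 2) x.
Proof.
intros Hf Hg Hne Hx.
assert (Hi : is_derive Rinv (g x) (- / g x ^ 2)).
{ auto_derive; [ exact Hne | field; exact Hne ]. }
apply deriv_at_ext
  with (4 := deriv_at_mult _ _ _ _ _ _ Hf (deriv_at_comp _ _ _ _ _ _ Hg Hi));
  [ reflexivity | field; exact Hne | exact Hx ].
Qed.

(** * Uniqueness of derivatives and the mean value theorem on an interval *)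

(** A second point [y] of the interval is within [eps] of [x], or else convexity provides the point
    at distance [eps / 2] from [x] towards [y]. *)
Lemma interval_limit_point (J : R -> Prop) (x : R) :
  is_interval J -> J x -> adhDa (D_x J x) x.
Proof.
intros [Hconv (a & b & Ha & Hb & Hab)] Hx eps Heps.
assert (Hy : exists y, J y /\ y <> x).
{ destruct (Req_dec a x); [ exists b | exists a ]; split; auto; lra. }
destruct Hy as (y & Hy & Hne).
destruct (Rlt_le_dec (Rabs (y - x)) eps) as [Hlt | Hle].
- exists y; repeat split; auto.
- destruct (Rtotal_order x y) as [H | [H | H]]; [ | lra | ].
  + rewrite Rabs_right in Hle by lra.
    exists (x + eps / 2); split; [ split | ]; [ | lra | ].
    * apply (Hconv x y); auto; lra.
    * unfold Rdist; rewrite Rabs_right; lra.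
  + rewrite Rabs_left in Hle by lra.
    exists (x - eps / 2); split; [ split | ]; [ | lra | ].
    * apply (Hconv y x); auto; lra.
    * unfold Rdist; rewrite Rabs_left; lra.
Qed.

Lemma deriv_at_unique (J : R -> Prop) (f : R -> R) (l k x : R) :
  is_interval J -> J x -> deriv_at J f l x -> deriv_at J f k x -> l = k.
Proof.
intros HJ Hx; apply single_limit, interval_limit_point; assumption.
Qed.

(* The relative derivatives say nothing on the function outside [J]; the
   two-sided mean value theorem is applied to [f] composed with the retraction
   of the line onto [a, b]. *)
Lemma deriv_on_MVT (J : R -> Prop) (f f' : R -> R) (a b : R) :
  is_interval J -> deriv_on J f f' -> J a -> J b -> a < b ->
  exists c, J c /\ f b - f a = f' c * (b - a).
Proof.
intros [Hconv _] Hf Ha Hb Hab.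
set (r := fun x => Rmax a (Rmin b x)).
assert (Hr : forall x, a <= r x <= b).
{ intros x; unfold r, Rmax, Rmin; repeat destruct (Rle_dec _ _); lra. }
assert (Hid : forall x, a <= x <= b -> r x = x).
{ intros x Hx; unfold r, Rmax, Rmin; repeat destruct (Rle_dec _ _); lra. }
assert (Hlip : forall x y, Rabs (r x - r y) <= Rabs (x - y)).
{ intros x y; unfold r, Rmax, Rmin, Rabs.
  repeat destruct (Rle_dec _ _); repeat destruct (Rcase_abs _); lra. }
assert (HrJ : forall x, J (r x)).
{ intros x; apply (Hconv a b); auto. }
destruct (MVT_gen (fun x => f (r x)) a b f') as (c & Hc & Heq).
- rewrite Rmin_left, Rmax_right by lra; intros x Hx.
  apply is_derive_Reals; intros eps Heps.
  assert (HxJ : J x) by (apply (Hconv a b); auto; lra).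
  destruct (Hf x HxJ eps Heps) as (alp & Halp & H).
  assert (Hd : 0 < Rmin alp (Rmin (x - a) (b - x))).
  { repeat apply Rmin_pos; lra. }
  exists (mkposreal _ Hd); intros h Hh Hlt; simpl in Hlt.
  assert (H1 := Rmin_l alp (Rmin (x - a) (b - x))).
  assert (H2 := Rmin_r alp (Rmin (x - a) (b - x))).
  assert (H3 := Rmin_l (x - a) (b - x)).
  assert (H4 := Rmin_r (x - a) (b - x)).
  assert (Hin : a <= x + h <= b).
  { revert Hlt; unfold Rabs; destruct (Rcase_abs h); intros; lra. }
  specialize (H (x + h)); simpl in H; unfold Rdist in H.
  rewrite !Hid by lra.
  replace h with (x + h - x) at 2 by ring.
  apply H; split; [ split | ].
  + apply (Hconv a b); auto.
  + lra.
  + replace (x + h - x) with h by ring; lra.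
- intros x _ eps Heps.
  destruct (cont_deriv f f' J (r x) (Hf _ (HrJ x)) eps Heps)
    as (alp & Halp & H).
  exists alp; split; [ exact Halp | ].
  intros y [_ Hy]; simpl in *; unfold Rdist in *.
  (* The relative limit excludes the base point itself, which the retraction may well hit. *)
  destruct (Req_dec (r y) (r x)) as [E | E].
  + rewrite E, Rminus_diag, Rabs_R0; exact Heps.
  + apply H; split; [ split; auto | ].
    apply Rle_lt_trans with (1 := Hlip y x); exact Hy.
- rewrite Rmin_left, Rmax_right in Hc by lra.
  rewrite !Hid in Heq by lra.
  exists c; split; [ apply (Hconv a b); auto | exact Heq ].
Qed.

Lemma deriv_0_const (J : R -> Prop) (f : R -> R) :
  is_interval J -> (forall x, J x -> deriv_at J f 0 x) ->
  exists c, forall x, J x -> f x = c.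
Proof.
intros HJ Hf.
assert (Hlt : forall a b, J a -> J b -> a < b -> f a = f b).
{ intros a b Ha Hb Hab.
  destruct (deriv_on_MVT J f (fun _ => 0) a b) as (c & _ & E); auto.
  lra. }
destruct HJ as [_ (a & _ & Ha & _)].
exists (f a); intros x Hx.
destruct (Rtotal_order x a) as [H | [-> | H]]; auto.
symmetry; auto.
Qed.

Lemma deriv_pos_increasing (J : R -> Prop) (f f' : R -> R) :
  is_interval J -> deriv_on J f f' -> (forall x, J x -> 0 < f' x) ->
  forall a b, J a -> J b -> a < b -> f a < f b.
Proof.
intros HJ Hf Hpos a b Ha Hb Hab.
destruct (deriv_on_MVT J f f' a b) as (c & Hc & E); auto.
specialize (Hpos c Hc); nra.
Qed.

(** * Change of parameter by an increasing function *)

Section Reparametrization.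

Variables (J : R -> Prop) (p p' : R -> R).
Hypotheses (HJ : is_interval J) (Hp : deriv_on J p p').
Hypothesis Hpos : forall s, J s -> 0 < p' s.

Lemma reparam_exists : exists q, reparam J p q.
Proof.
assert (Hinc := deriv_pos_increasing J p p' HJ Hp Hpos).
(* For [u] outside the image the implication is vacuous and the default 0 serves; this makes the
   chosen inverse total. *)
assert (H : forall u, exists s, forall s', J s' -> p s' = u -> s = s').
{ intros u.
  destruct (classic (exists s, J s /\ p s = u)) as [(s & Hs & <-) | Hno].
  - exists s; intros s' Hs' E.
    destruct (Rtotal_order s s') as [Hlt | [Heq | Hlt]]; [ | exact Heq | ].
    + assert (p s < p s') by auto; lra.
    + assert (p s' < p s) by auto; lra.
  - exists 0; intros s' Hs' E; destruct Hno; eauto. }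
exists (fun u => proj1_sig (constructive_indefinite_description _ (H u))).
intros s Hs.
exact (proj2_sig (constructive_indefinite_description _ (H (p s))) s Hs
         eq_refl).
Qed.

(** Each side is treated separately. If [s0 + eps] is in [J], monotonicity makes the increment of
    [p] up to that point a valid bound; if not, convexity leaves no point of [J] at or beyond it,
    and any bound, here 1, works. *)
Lemma increasing_inverse_continuous (s0 eps : R) :
  J s0 -> 0 < eps ->
  exists delta, 0 < delta /\
    forall s, J s -> Rabs (p s - p s0) < delta -> Rabs (s - s0) < eps.
Proof.
intros Hs0 Heps.
assert (Hinc := deriv_pos_increasing J p p' HJ Hp Hpos).
destruct HJ as [Hconv _].
assert (Hr : exists d, 0 < d /\
  forall s, J s -> p s - p s0 < d -> s - s0 < eps).
{ destruct (classic (J (s0 + eps))) as [H | H].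
  - exists (p (s0 + eps) - p s0); split.
    + assert (p s0 < p (s0 + eps)) by (apply Hinc; auto; lra); lra.
    + intros s Hs Hlt; apply Rnot_le_lt; intros Hle.
      destruct (Req_dec s (s0 + eps)) as [E | E]; [ subst s; lra | ].
      assert (p (s0 + eps) < p s) by (apply Hinc; auto; lra); lra.
  - exists 1; split; [ lra | ]; intros s Hs _.
    apply Rnot_le_lt; intros Hle; apply H.
    apply (Hconv s0 s); auto; lra. }
assert (Hl : exists d, 0 < d /\
  forall s, J s -> p s0 - p s < d -> s0 - s < eps).
{ destruct (classic (J (s0 - eps))) as [H | H].
  - exists (p s0 - p (s0 - eps)); split.
    + assert (p (s0 - eps) < p s0) by (apply Hinc; auto; lra); lra.
    + intros s Hs Hlt; apply Rnot_le_lt; intros Hle.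
      destruct (Req_dec s (s0 - eps)) as [E | E]; [ subst s; lra | ].
      assert (p s < p (s0 - eps)) by (apply Hinc; auto; lra); lra.
  - exists 1; split; [ lra | ]; intros s Hs _.
    apply Rnot_le_lt; intros Hle; apply H.
    apply (Hconv s s0); auto; lra. }
destruct Hr as (d1 & Hd1 & Hr), Hl as (d2 & Hd2 & Hl).
exists (Rmin d1 d2); split; [ apply Rmin_pos; auto | ].
intros s Hs Hlt.
apply Rabs_def2 in Hlt.
assert (H1 := Rmin_l d1 d2); assert (H2 := Rmin_r d1 d2).
assert (H3 : s - s0 < eps) by (apply Hr; auto; lra).
assert (H4 : s0 - s < eps) by (apply Hl; auto; lra).
apply Rabs_def1; lra.
Qed.

(** The substitution rule, proved on difference quotients: the quotient of [f] against [p] is the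
    ratio of the quotients of [f] and [p] against [s], and continuity of the inverse turns the limit
    in [s] into a limit in [p s]. *)
Lemma antideriv_reparam (q f f' g : R -> R) :
  reparam J p q -> deriv_on J f f' ->
  (forall s, J s -> f' s = p' s * g (p s)) ->
  antideriv (image_dir p J) g (fun u => f (q u)).
Proof.
intros Hq Hf Hg u (s0 & -> & Hs0).
assert (Hlim : limit1_in (fun s => (f s - f s0) / (p s - p s0))
                 (D_x J s0) (g (p s0)) s0).
{ assert (Hne : p' s0 <> 0) by (specialize (Hpos s0 Hs0); lra).
  replace (g (p s0)) with (f' s0 * / p' s0) by (rewrite Hg; auto; field; auto).
  refine (limit1_ext _ _ _ _ _ _
            (limit_mul _ _ _ _ _ _ (Hf s0 Hs0)
               (limit_inv _ _ _ _ (Hp s0 Hs0) Hne))).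
  intros s [Hs Hss].
  assert (p s <> p s0).
  { intros E; rewrite <- (Hq s Hs), <- (Hq s0 Hs0), E in Hss; auto. }
  field; split; lra. }
intros eps Heps.
destruct (Hlim eps Heps) as (alp & Halp & H).
destruct (increasing_inverse_continuous s0 alp Hs0 Halp) as (d & Hd & Hc).
exists d; split; [ exact Hd | ].
intros v [[(s & -> & Hs) Hne] Hdist]; simpl in *; unfold Rdist in *.
rewrite !Hq by assumption.
apply H; split; [ split; [ exact Hs | congruence ] | ].
apply Hc; assumption.
Qed.

End Reparametrization.

(** * Rotation of the principal normal about the axis *)

Lemma is_derive_asin (x : R) :
  -1 < x < 1 -> is_derive asin x (/ sqrt (1 - x ^ 2)).
Proof.
intros Hx; apply is_derive_Reals.
replace (/ sqrt (1 - x ^ 2)) with (derive_pt asin x (derivable_pt_asin x Hx)).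
- exact (proj2_sig (derivable_pt_asin x Hx)).
- rewrite derive_pt_asin, Rsqr_pow2; unfold Rdiv; apply Rmult_1_l.
Qed.

(* In coordinates whose third axis is the axis of the helix, the tangent is
   [(x, y, n th)] and the principal normal is [(p, q, n)]. *)
Section SphericalImage.

Variables (J : R -> Prop) (x y th k p q p' q' : R -> R) (n m r : R).
Hypotheses (HJ : is_interval J) (Hn : 0 < Rabs n < 1) (Hr : 0 < r)
  (Hrn : r ^ 2 = 1 - n ^ 2) (Hm : m = n / r)
  (Hk : forall s, J s -> 0 < k s)
  (Hx : deriv_on J x (fun s => k s * p s))
  (Hy : deriv_on J y (fun s => k s * q s))
  (Hth : deriv_on J th k)
  (Hp : deriv_on J p p')
  (Hq : deriv_on J q q')
  (HT : forall s, J s -> x s ^ 2 + y s ^ 2 + n ^ 2 * th s ^ 2 = 1)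
  (HN : forall s, J s -> p s ^ 2 + q s ^ 2 = r ^ 2).

(** On [J] this is the absolute value of the third coordinate of the binormal; in the parameter [t]
    it is [r cos (n t)]. *)
Definition beta (s : R) : R := sqrt (r ^ 2 - n ^ 2 * th s ^ 2).

(* The third coordinate of the binormal. *)
Definition binormal3 (s : R) : R := x s * q s - y s * p s.

(** Differentiating [<T, T> = 1] gives [2 k <T, N> = 0], and [k] is positive. *)
Lemma tangent_normal_orthogonal (s : R) :
  J s -> x s * p s + y s * q s + n ^ 2 * th s = 0.
Proof.
intros Hs.
assert (D : deriv_at J
  (fun s => (x s * x s + y s * y s) + n ^ 2 * (th s * th s)) 0 s).
{ apply deriv_at_ext with (fun _ : R => 1) 0; auto using deriv_at_const.
  intros t Ht; rewrite <- (HT t Ht); ring. }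
assert (D' := deriv_at_plus _ _ _ _ _ _
  (deriv_at_plus _ _ _ _ _ _
    (deriv_at_mult _ _ _ _ _ _ (Hx s Hs) (Hx s Hs))
    (deriv_at_mult _ _ _ _ _ _ (Hy s Hs) (Hy s Hs)))
  (deriv_at_scal _ (n ^ 2) _ _ _
    (deriv_at_mult _ _ _ _ _ _ (Hth s Hs) (Hth s Hs)))).
assert (E := deriv_at_unique _ _ _ _ _ HJ Hs D D'); cbv beta in E.
assert (Hks := Hk s Hs); apply Rmult_eq_reg_l with (2 * k s); lra.
Qed.

Lemma normal_derivative_orthogonal (s : R) :
  J s -> p s * p' s + q s * q' s = 0.
Proof.
intros Hs.
assert (D : deriv_at J (fun s => p s * p s + q s * q s) 0 s).
{ apply deriv_at_ext with (fun _ : R => r ^ 2) 0; auto using deriv_at_const.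
  intros t Ht; rewrite <- (HN t Ht); ring. }
assert (D' := deriv_at_plus _ _ _ _ _ _
    (deriv_at_mult _ _ _ _ _ _ (Hp s Hs) (Hp s Hs))
    (deriv_at_mult _ _ _ _ _ _ (Hq s Hs) (Hq s Hs))).
assert (E := deriv_at_unique _ _ _ _ _ HJ Hs D D'); cbv beta in E; lra.
Qed.

(** Derivative of [<T, N> = 0]: the part [<T', N>] is [k <N, N> = k], and the constant third
    coordinate of [N] contributes nothing to [N']. *)
Lemma tangent_normal_derivative (s : R) :
  J s -> x s * p' s + y s * q' s = - k s.
Proof.
intros Hs.
assert (D : deriv_at J
  (fun s => (x s * p s + y s * q s) + n ^ 2 * th s) 0 s).
{ apply deriv_at_ext with (fun _ : R => 0) 0; auto using deriv_at_const.
  intros t Ht; rewrite (tangent_normal_orthogonal t Ht); ring. }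
assert (D' := deriv_at_plus _ _ _ _ _ _
  (deriv_at_plus _ _ _ _ _ _
    (deriv_at_mult _ _ _ _ _ _ (Hx s Hs) (Hp s Hs))
    (deriv_at_mult _ _ _ _ _ _ (Hy s Hs) (Hq s Hs)))
  (deriv_at_scal _ (n ^ 2) _ _ _ (Hth s Hs))).
assert (E := deriv_at_unique _ _ _ _ _ HJ Hs D D'); cbv beta in E.
assert (E1 := HN s Hs).
replace (k s) with (k s * (p s ^ 2 + q s ^ 2 + n ^ 2))
  by (rewrite E1, Hrn; ring).
lra.
Qed.

(* The angular velocity of the normal about the axis. *)
Definition rotation (s : R) : R := (p s * q' s - q s * p' s) / r ^ 2.

(** In the plane, [(p', q')] is orthogonal to [(p, q)], hence a multiple of [(- q, p)]. *)
Lemma normal_derivative (s : R) :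
  J s -> p' s = - (rotation s * q s) /\ q' s = rotation s * p s.
Proof.
intros Hs.
assert (E := HN s Hs); assert (E' := normal_derivative_orthogonal s Hs).
assert (E0 : p' s * p s = - (q' s * q s)) by lra.
unfold rotation; split; apply Rmult_eq_reg_l with (r ^ 2); try nra.
- transitivity (q s * p' s * q s - p s * q' s * q s); [ | field; lra ].
  rewrite <- E; ring [E0].
- transitivity (p s * q' s * p s - q s * p' s * p s); [ | field; lra ].
  rewrite <- E; ring [E0].
Qed.

Lemma binormal3_rotation (s : R) : J s -> rotation s * binormal3 s = k s.
Proof.
intros Hs.
assert (E := tangent_normal_derivative s Hs).
destruct (normal_derivative s Hs) as [Ep Eq].
rewrite Ep, Eq in E; unfold binormal3; lra.
Qed.

(** Lagrange's identity for the plane vectors [(x, y)] and [(p, q)], whose lengths and scalar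
    product are known in terms of [th]. *)
Lemma binormal3_sqr (s : R) :
  J s -> binormal3 s ^ 2 = r ^ 2 - n ^ 2 * th s ^ 2.
Proof.
intros Hs.
assert (E := tangent_normal_orthogonal s Hs).
assert (E1 := HT s Hs); assert (E2 := HN s Hs).
replace (binormal3 s ^ 2) with
  ((x s ^ 2 + y s ^ 2) * (p s ^ 2 + q s ^ 2) - (x s * p s + y s * q s) ^ 2)
  by (unfold binormal3; ring).
rewrite E2.
replace (x s ^ 2 + y s ^ 2) with (1 - n ^ 2 * th s ^ 2) by lra.
replace (x s * p s + y s * q s) with (- n ^ 2 * th s) by lra.
rewrite Hrn; ring.
Qed.

Lemma binormal3_neq0 (s : R) : J s -> binormal3 s <> 0.
Proof.
intros Hs E; assert (Hks := Hk s Hs).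
rewrite <- (binormal3_rotation s Hs), E in Hks; lra.
Qed.

Lemma beta_arg_pos (s : R) : J s -> 0 < r ^ 2 - n ^ 2 * th s ^ 2.
Proof.
intros Hs; rewrite <- (binormal3_sqr s Hs).
apply pow2_gt_0, binormal3_neq0, Hs.
Qed.

Lemma beta_pos (s : R) : J s -> 0 < beta s.
Proof. intros Hs; apply sqrt_lt_R0, beta_arg_pos, Hs. Qed.

Lemma beta_sqr (s : R) : J s -> beta s ^ 2 = r ^ 2 - n ^ 2 * th s ^ 2.
Proof.
intros Hs; apply pow2_sqrt, Rlt_le, beta_arg_pos, Hs.
Qed.

Lemma deriv_beta (s : R) :
  J s -> deriv_at J beta (- (k s * n ^ 2 * th s) / beta s) s.
Proof.
intros Hs; assert (Hb := beta_pos s Hs).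
assert (D : is_derive (fun u => sqrt (r ^ 2 - n ^ 2 * u ^ 2)) (th s)
              (- n ^ 2 * th s / beta s)).
{ auto_derive.
  - assert (H := beta_arg_pos s Hs); simpl in *; lra.
  - change (- (n ^ 2 * (1 * (2 * (th s * 1)))) * / (2 * beta s) =
            - n ^ 2 * th s / beta s).
    field; lra. }
refine (deriv_at_ext _ _ _ _ _ _ (fun _ _ => eq_refl) _ Hs
          (deriv_at_comp _ _ _ _ _ _ (Hth s Hs) D)).
field; lra.
Qed.

(** The terms from [x'] and [y'] cancel because [T'] is parallel to [N]; the others add up to
    [rotation] times [x p + y q]. *)
Lemma deriv_binormal3 (s : R) :
  J s -> deriv_at J binormal3 (- (rotation s * n ^ 2 * th s)) s.
Proof.
intros Hs.
assert (D := deriv_at_plus _ _ _ _ _ _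
  (deriv_at_mult _ _ _ _ _ _ (Hx s Hs) (Hq s Hs))
  (deriv_at_scal _ (-1) _ _ _
    (deriv_at_mult _ _ _ _ _ _ (Hy s Hs) (Hp s Hs)))).
apply deriv_at_ext with (4 := D); auto.
- intros t _; unfold binormal3; ring.
- destruct (normal_derivative s Hs) as [Ep Eq].
  rewrite Ep, Eq; assert (E := tangent_normal_orthogonal s Hs).
  replace (n ^ 2 * th s) with (- (x s * p s + y s * q s)) by lra.
  transitivity (rotation s * (x s * p s + y s * q s)); [ ring | ].
  rewrite Rmult_assoc; replace (n ^ 2 * th s) with (- (x s * p s + y s * q s)) by lra.
  ring.
Qed.

(* The sign of the third coordinate of the binormal is constant because its
   quotient by [beta] has zero derivative. *)
Lemma binormal3_sign :
  exists eps, eps ^ 2 = 1 /\ forall s, J s -> binormal3 s = eps * beta s.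
Proof.
destruct (deriv_0_const J (fun s => binormal3 s / beta s)) as (eps & H); auto.
{ intros s Hs; assert (Hb := beta_pos s Hs).
  assert (Hb' := Rgt_not_eq _ _ Hb).
  apply deriv_at_ext
    with (4 := deriv_at_div _ _ _ _ _ _ (deriv_binormal3 s Hs)
                 (deriv_beta s Hs) Hb' Hs); auto.
  assert (E : beta s ^ 2 = binormal3 s ^ 2).
  { rewrite binormal3_sqr, beta_sqr; auto. }
  (* Once [k] is replaced by the product of [rotation] and [binormal3], the quotient rule yields a
     multiple of [binormal3 ^ 2 - beta ^ 2], which is zero. *)
  rewrite <- (binormal3_rotation s Hs).
  transitivity (rotation s * n ^ 2 * th s * (binormal3 s ^ 2 - beta s ^ 2) / beta s ^ 3);
    [ field; auto | rewrite E; field; auto ]. }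
assert (Heps : forall s, J s -> binormal3 s = eps * beta s).
{ intros s Hs; rewrite <- (H s Hs); field.
  apply Rgt_not_eq, beta_pos, Hs. }
exists eps; split; [ | exact Heps ].
destruct HJ as [_ (a & _ & Ha & _)].
assert (Hb := beta_pos a Ha).
apply Rmult_eq_reg_r with (beta a ^ 2); [ | nra ].
rewrite <- Rpow_mult_distr, <- Heps, binormal3_sqr, beta_sqr; auto; ring.
Qed.

Definition tparam (s : R) : R := 1 / n * asin (m * th s).

(** Since [n = m r], the radicand of [beta] factors as [r ^ 2 (1 - (m th) ^ 2)]; its positivity
    gives the strict bound. *)
Lemma beta_asin (s : R) :
  J s -> -1 < m * th s < 1 /\ beta s = r * cos (asin (m * th s)).
Proof.
intros Hs; assert (Ha := beta_arg_pos s Hs).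
assert (E : r ^ 2 - n ^ 2 * th s ^ 2 = r ^ 2 * (1 - (m * th s) ^ 2)).
{ rewrite Hm; field; lra. }
rewrite E in Ha.
assert (H1 : 0 < 1 - (m * th s) ^ 2) by (apply Rmult_lt_reg_l with (r ^ 2); nra).
assert (Hlt : -1 < m * th s < 1) by (split; nra).
split; [ exact Hlt | ].
rewrite cos_asin, Rsqr_pow2 by lra.
unfold beta; rewrite E, sqrt_mult_alt, sqrt_pow2; try lra.
apply pow2_ge_0.
Qed.

Lemma deriv_tparam (s : R) : J s -> deriv_at J tparam (k s / beta s) s.
Proof.
intros Hs.
assert (Hn0 : n <> 0) by (intros ->; rewrite Rabs_R0 in Hn; lra).
destruct (beta_asin s Hs) as (Hlt & Hb).
assert (Hbpos := beta_pos s Hs).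
rewrite cos_asin, Rsqr_pow2 in Hb by lra.
assert (D := deriv_at_scal _ (1 / n) _ _ _
  (deriv_at_comp _ _ _ _ _ _ (deriv_at_scal _ m _ _ _ (Hth s Hs))
     (is_derive_asin _ Hlt))).
apply deriv_at_ext with (4 := D); auto.
replace (sqrt (1 - (m * th s) ^ 2)) with (beta s / r)
  by (rewrite Hb; field; lra).
rewrite Hm; field; repeat split; lra.
Qed.

(** The sign [eps] makes [(p, eps q)] turn with angular velocity [k / beta], the derivative of
    [tparam]. Turned back by the angle [tparam] it has zero derivative, so it is a constant vector
    [(u, v)]; no initial angle has to be chosen. *)
Lemma normal_angle :
  exists u v eps, eps ^ 2 = 1 /\ u ^ 2 + v ^ 2 = r ^ 2 /\
    forall s, J s ->
      p s = u * cos (tparam s) - v * sin (tparam s) /\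
      eps * q s = u * sin (tparam s) + v * cos (tparam s).
Proof.
destruct binormal3_sign as (eps & Heps & Hb3).
assert (Hspeed : forall s, J s -> rotation s = eps * (k s / beta s)).
{ intros s Hs; assert (Hb := beta_pos s Hs).
  rewrite <- (binormal3_rotation s Hs), Hb3 by exact Hs.
  transitivity (eps ^ 2 * rotation s); [ rewrite Heps; ring | field; lra ]. }
assert (Dc : forall s, J s -> deriv_at J (fun s => cos (tparam s))
               (k s / beta s * - sin (tparam s)) s).
{ intros s Hs; apply deriv_at_comp; [ exact (deriv_tparam s Hs) | ].
  auto_derive; auto; ring. }
assert (Ds : forall s, J s -> deriv_at J (fun s => sin (tparam s))
               (k s / beta s * cos (tparam s)) s).
{ intros s Hs; apply deriv_at_comp; [ exact (deriv_tparam s Hs) | ].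
  auto_derive; auto; ring. }
destruct (deriv_0_const J
  (fun s => p s * cos (tparam s) + eps * (q s * sin (tparam s)))) as (u & Hu); auto.
{ intros s Hs; destruct (normal_derivative s Hs) as [Ep Eq].
  refine (deriv_at_ext _ _ _ _ _ _ (fun _ _ => eq_refl) _ Hs
   (deriv_at_plus _ _ _ _ _ _
     (deriv_at_mult _ _ _ _ _ _ (Hp s Hs) (Dc s Hs))
     (deriv_at_scal _ eps _ _ _
     (deriv_at_mult _ _ _ _ _ _ (Hq s Hs) (Ds s Hs))))).
  rewrite Ep, Eq, (Hspeed s Hs); ring [Heps]. }
destruct (deriv_0_const J
  (fun s => eps * (q s * cos (tparam s)) + -1 * (p s * sin (tparam s))))
  as (v & Hv); auto.
{ intros s Hs; destruct (normal_derivative s Hs) as [Ep Eq].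
  refine (deriv_at_ext _ _ _ _ _ _ (fun _ _ => eq_refl) _ Hs
   (deriv_at_plus _ _ _ _ _ _
     (deriv_at_scal _ eps _ _ _
     (deriv_at_mult _ _ _ _ _ _ (Hq s Hs) (Dc s Hs)))
     (deriv_at_scal _ (-1) _ _ _
     (deriv_at_mult _ _ _ _ _ _ (Hp s Hs) (Ds s Hs))))).
  rewrite Ep, Eq, (Hspeed s Hs); ring [Heps]. }
assert (Hcs : forall t, sin t ^ 2 = 1 - cos t ^ 2).
{ intros t; assert (H := sin2_cos2 t); rewrite !Rsqr_pow2 in H; lra. }
exists u, v, eps; split; [ exact Heps | split ].
- destruct HJ as [_ (a & _ & Ha & _)].
  rewrite <- (Hu a Ha), <- (Hv a Ha), <- (HN a Ha).
  ring [Heps (Hcs (tparam a))].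
- intros s Hs; rewrite <- (Hu s Hs), <- (Hv s Hs).
  split; ring [Heps (Hcs (tparam s))].
Qed.

End SphericalImage.

(** * Derivatives on a whole interval, for functions and for curves *)

Lemma deriv_onI (J : R -> Prop) (f f' : R -> R) :
  (forall s, J s -> deriv_at J f (f' s) s) -> deriv_on J f f'.
Proof. intros H s Hs; exact (H s Hs). Qed.

Lemma deriv_on_ext (J : R -> Prop) (f g f' g' : R -> R) :
  (forall s, J s -> f s = g s) -> (forall s, J s -> f' s = g' s) ->
  deriv_on J f f' -> deriv_on J g g'.
Proof.
intros Hfg Hfg' H; apply deriv_onI; intros s Hs.
apply deriv_at_ext with (4 := deriv_onE _ _ _ _ H Hs); auto.
Qed.

Lemma deriv_on_scal (J : R -> Prop) (a : R) (f f' : R -> R) :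
  deriv_on J f f' -> deriv_on J (fun s => a * f s) (fun s => a * f' s).
Proof. intros H s Hs; exact (Dmult_const _ _ _ _ a (H s Hs)). Qed.

Lemma deriv_on_plus (J : R -> Prop) (f f' g g' : R -> R) :
  deriv_on J f f' -> deriv_on J g g' ->
  deriv_on J (fun s => f s + g s) (fun s => f' s + g' s).
Proof. intros Hf Hg s Hs; exact (Dadd _ _ _ _ _ _ (Hf s Hs) (Hg s Hs)). Qed.

Lemma deriv_on_div_const (J : R -> Prop) (a : R) (g g' h : R -> R) :
  a <> 0 -> (forall s, J s -> g' s = a * h s) ->
  deriv_on J g g' -> deriv_on J (fun s => / a * g s) h.
Proof.
intros Ha E Hg.
apply deriv_on_ext with (3 := deriv_on_scal _ (/ a) _ _ Hg); auto.
intros s Hs; rewrite E by exact Hs; field; exact Ha.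
Qed.

Lemma deriv_on_unique (J : R -> Prop) (f f' g' : R -> R) :
  is_interval J -> deriv_on J f f' -> deriv_on J f g' ->
  forall s, J s -> f' s = g' s.
Proof.
intros HJ Hf Hg s Hs.
exact (deriv_at_unique _ _ _ _ _ HJ Hs (Hf s Hs) (Hg s Hs)).
Qed.

(** The derivatives supplied by [class_C] are a priori unrelated to [f'] and [f'']; uniqueness on an
    interval identifies them. *)
Lemma second_derivative_differentiable (J : R -> Prop) (f f' f'' : R -> R) :
  is_interval J -> class_C 4 J f -> deriv_on J f f' -> deriv_on J f' f'' ->
  exists f''', deriv_on J f'' f'''.
Proof.
intros HJ (g1 & H1 & g2 & H2 & g3 & H3 & _) Hf Hf'.
assert (E1 := deriv_on_unique _ _ _ _ HJ H1 Hf).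
assert (H2' := deriv_on_ext _ _ _ _ _ E1 (fun _ _ => eq_refl) H2).
assert (E2 := deriv_on_unique _ _ _ _ HJ H2' Hf').
exists g3; exact (deriv_on_ext _ _ _ _ _ E2 (fun _ _ => eq_refl) H3).
Qed.

Lemma vderiv_on_dot (J : R -> Prop) (c c' : R -> E3) (e : E3) :
  vderiv_on J c c' -> deriv_on J (fun s => dot (c s) e) (fun s => dot (c' s) e).
Proof.
intros (H1 & H2 & H3).
apply deriv_on_ext with
  (3 := deriv_on_plus _ _ _ _ _ (deriv_on_plus _ _ _ _ _
          (deriv_on_scal _ (x1 e) _ _ H1) (deriv_on_scal _ (x2 e) _ _ H2))
          (deriv_on_scal _ (x3 e) _ _ H3));
  intros s _; unfold dot; ring.
Qed.

Lemma vderiv_on_unique (J : R -> Prop) (c c' c'' : R -> E3) :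
  is_interval J -> vderiv_on J c c' -> vderiv_on J c c'' ->
  forall s, J s -> c' s = c'' s.
Proof.
intros HJ (H1 & H2 & H3) (K1 & K2 & K3) s Hs.
assert (E1 := deriv_on_unique _ _ _ _ HJ H1 K1 s Hs).
assert (E2 := deriv_on_unique _ _ _ _ HJ H2 K2 s Hs).
assert (E3 := deriv_on_unique _ _ _ _ HJ H3 K3 s Hs).
cbv beta in E1, E2, E3; destruct (c' s), (c'' s); simpl in *; congruence.
Qed.

(** * Scalar products and an orthonormal frame containing the axis *)

Lemma norm_sqr (p : E3) : norm p ^ 2 = dot p p.
Proof. apply pow2_sqrt; unfold dot; nra. Qed.

Lemma dot_scal (a : R) (p q : E3) : dot (scal a p) q = a * dot p q.
Proof. unfold dot, scal; simpl; ring. Qed.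

(* Away from [d = (0, 0, -1)], the vectors are the images of the first two
   basis vectors under the least rotation taking [(0, 0, 1)] to [d]. *)
Lemma orthonormal_completion (d : E3) :
  dot d d = 1 ->
  exists e1 e2, forall w,
    dot w e1 ^ 2 + dot w e2 ^ 2 + dot w d ^ 2 = dot w w.
Proof.
destruct d as [a b c]; unfold dot; simpl; intros Hd.
destruct (Req_dec (1 + c) 0) as [Hc | Hc].
- exists (mkE3 1 0 0), (mkE3 0 1 0); intros [w1 w2 w3]; simpl.
  assert (c = -1) by lra; subst c.
  assert (a = 0) by nra; assert (b = 0) by nra; subst a b; ring.
- exists (mkE3 (1 - a * a / (1 + c)) (- (a * b) / (1 + c)) (- a)),
    (mkE3 (- (a * b) / (1 + c)) (1 - b * b / (1 + c)) (- b)).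
  intros [w1 w2 w3]; simpl.
  assert (Hb : b * b = 1 - a * a - c * c) by lra.
  field_simplify_eq; [ ring [Hb] | exact Hc ].
Qed.

(** * From the natural representation to the parameters [theta] and [t] *)

Section Representations.

Variables (J : R -> Prop) (th k A B : R -> R) (f : R -> E3) (n m r : R).
Hypotheses (HJ : is_interval J) (Hn : n <> 0) (Hr : 0 < r) (Hm : m = n / r)
  (Hk : forall s, J s -> 0 < k s) (Hth : deriv_on J th k).

Let tp (s : R) : R := 1 / n * asin (m * th s).

Hypotheses (Hlt : forall s, J s -> -1 < m * th s < 1)
  (HA : deriv_on J A (fun s => k s * cos (tp s)))
  (HB : deriv_on J B (fun s => k s * sin (tp s)))
  (H1 : deriv_on J (fun s => x1 (f s)) (fun s => r * A s))
  (H2 : deriv_on J (fun s => x2 (f s)) (fun s => r * B s))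
  (H3 : deriv_on J (fun s => x3 (f s)) (fun s => n * th s)).

Lemma m_neq0 : m <> 0.
Proof.
rewrite Hm; apply Rmult_integral_contrapositive_currified; auto.
apply Rinv_neq_0_compat; lra.
Qed.

Lemma natural_representation :
  exists A B P Q Z : R -> R,
    antideriv J (fun s => k s * cos (1 / n * asin (m * th s))) A /\
    antideriv J (fun s => k s * sin (1 / n * asin (m * th s))) B /\
    antideriv J A P /\
    antideriv J B Q /\
    antideriv J th Z /\
    forall s, J s -> f s = mkE3 (n / m * P s) (n / m * Q s) (n * Z s).
Proof.
(* The divisors are the coefficients of the formulas, as [n / m = r]. *)
exists A, B, (fun s => / r * x1 (f s)), (fun s => / r * x2 (f s)),
  (fun s => / n * x3 (f s)).
split; [ exact HA | split; [ exact HB | ] ].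
split; [ apply deriv_on_div_const with (3 := H1); auto; lra | ].
split; [ apply deriv_on_div_const with (3 := H2); auto; lra | ].
split; [ apply deriv_on_div_const with (3 := H3); auto; lra | ].
intros s _; destruct (f s) as [a b c]; simpl.
f_equal; rewrite ?Hm; field; repeat split; auto; lra.
Qed.

(** Substitution [du = k ds] in the natural representation: the same antiderivatives, composed with
    the inverse of [th]. *)
Lemma theta_representation :
  exists sigma : R -> R,
    reparam J th sigma /\
    let K := image_dir th J in
    exists A B P Q Z : R -> R,
      antideriv K (fun u => cos (1 / n * asin (m * u))) A /\
      antideriv K (fun u => sin (1 / n * asin (m * u))) B /\
      antideriv K (fun u => 1 / k (sigma u) * A u) P /\
      antideriv K (fun u => 1 / k (sigma u) * B u) Q /\
      antideriv K (fun u => u / k (sigma u)) Z /\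
      forall u, K u ->
        f (sigma u) = mkE3 (n / m * P u) (n / m * Q u) (n * Z u).
Proof.
destruct (reparam_exists J th k HJ Hth Hk) as (q & Hq).
exists q; split; [ exact Hq | ]; intros K.
destruct natural_representation
  as (A' & B' & P & Q & Z & DA & DB & DP & DQ & DZ & E).
exists (fun u => A' (q u)), (fun u => B' (q u)), (fun u => P (q u)),
  (fun u => Q (q u)), (fun u => Z (q u)).
split; [ | split; [ | split; [ | split; [ | split ] ] ] ].
- apply (antideriv_reparam J th k HJ Hth Hk) with (2 := DA); auto.
- apply (antideriv_reparam J th k HJ Hth Hk) with (2 := DB); auto.
- apply (antideriv_reparam J th k HJ Hth Hk) with (2 := DP); auto.
  intros s Hs; rewrite (Hq s Hs); field; apply Rgt_not_eq, Hk, Hs.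
- apply (antideriv_reparam J th k HJ Hth Hk) with (2 := DQ); auto.
  intros s Hs; rewrite (Hq s Hs); field; apply Rgt_not_eq, Hk, Hs.
- apply (antideriv_reparam J th k HJ Hth Hk) with (2 := DZ); auto.
  intros s Hs; rewrite (Hq s Hs); field; apply Rgt_not_eq, Hk, Hs.
- intros u (s & -> & Hs); rewrite !(Hq s Hs); auto.
Qed.

(** Substitution [dt = k ds / (r cos (n t))]. Since [m / n = 1 / r] is positive, [t] increases with
    [s] for either sign of [n]. *)
Lemma t_representation :
  let tpar := fun s => 1 / n * asin (m * th s) in
  exists sigma : R -> R,
    reparam J tpar sigma /\
    let K := image_dir tpar J in
    exists A B P Q Z : R -> R,
      antideriv K (fun t => cos t * cos (n * t)) A /\
      antideriv K (fun t => sin t * cos (n * t)) B /\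
      antideriv K (fun t => cos (n * t) / k (sigma t) * A t) P /\
      antideriv K (fun t => cos (n * t) / k (sigma t) * B t) Q /\
      antideriv K (fun t => sin (n * t) * cos (n * t) / k (sigma t)) Z /\
      forall t, K t ->
        f (sigma t) =
          mkE3 (n ^ 3 / m ^ 3 * P t) (n ^ 3 / m ^ 3 * Q t)
               (n ^ 2 / m ^ 2 * Z t).
Proof.
intros tpar.
assert (Hnt : forall s, n * tpar s = asin (m * th s)).
{ intros s; unfold tpar; field; exact Hn. }
assert (Hsin : forall s, J s -> sin (n * tpar s) = m * th s).
{ intros s Hs; assert (H := Hlt s Hs); rewrite Hnt, sin_asin; lra. }
assert (Hcos : forall s, J s -> 0 < cos (n * tpar s)).
{ intros s Hs; assert (H := Hlt s Hs); rewrite Hnt.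
  apply cos_gt_0; apply asin_bound_lt; exact H. }
assert (Dt : deriv_on J tpar (fun s => k s / (r * cos (n * tpar s)))).
{ intros s Hs; assert (H := Hcos s Hs); assert (H' := Hlt s Hs).
  apply (deriv_at_ext _ _ _ _ _ _ (fun _ _ => eq_refl)) with
    (3 := deriv_at_scal _ (1 / n) _ _ _
            (deriv_at_comp _ _ _ _ _ _
               (deriv_at_scal _ m _ _ _ (Hth s Hs))
               (is_derive_asin _ H'))); auto.
  rewrite Hnt, cos_asin, Rsqr_pow2 in * by lra.
  rewrite Hm at 1; field; repeat split; lra. }
assert (Hpos : forall s, J s -> 0 < k s / (r * cos (n * tpar s))).
{ intros s Hs; apply Rdiv_lt_0_compat; auto; apply Rmult_lt_0_compat; auto. }
destruct (reparam_exists J tpar _ HJ Dt Hpos) as (q & Hq).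
exists q; split; [ exact Hq | ]; intros K.
destruct natural_representation
  as (A' & B' & P & Q & Z & DA & DB & DP & DQ & DZ & E).
assert (Hm0 := m_neq0).
(* Each integration in [t] brings a factor [r], removed from [A'] and [B'] once and from [P] and [Q]
   twice; in [Z] the factor [m / r] also accounts for [th = sin (n t) / m]. The coefficients
   [n ^ 3 / m ^ 3 = r ^ 3] and [n ^ 2 / m ^ 2 = r ^ 2] restore the scale. *)
exists (fun u => / r * A' (q u)), (fun u => / r * B' (q u)),
  (fun u => / r ^ 2 * P (q u)), (fun u => / r ^ 2 * Q (q u)),
  (fun u => m / r * Z (q u)).
assert (Hne : forall s, J s -> k s <> 0 /\ cos (n * tpar s) <> 0 /\ r <> 0).
{ intros s Hs; repeat split; apply Rgt_not_eq; [ apply Hk | apply Hcos | ]; assumption. }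
split; [ | split; [ | split; [ | split; [ | split ] ] ] ].
- apply (antideriv_reparam J tpar _ HJ Dt Hpos)
    with (2 := deriv_on_scal _ (/ r) _ _ DA); auto.
  intros s Hs; destruct (Hne s Hs) as (N1 & N2 & N3).
  fold (tpar s); field; auto.
- apply (antideriv_reparam J tpar _ HJ Dt Hpos)
    with (2 := deriv_on_scal _ (/ r) _ _ DB); auto.
  intros s Hs; destruct (Hne s Hs) as (N1 & N2 & N3).
  fold (tpar s); field; auto.
- apply (antideriv_reparam J tpar _ HJ Dt Hpos)
    with (2 := deriv_on_scal _ (/ r ^ 2) _ _ DP); auto.
  intros s Hs; destruct (Hne s Hs) as (N1 & N2 & N3).
  rewrite (Hq s Hs); field; auto.
- apply (antideriv_reparam J tpar _ HJ Dt Hpos)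
    with (2 := deriv_on_scal _ (/ r ^ 2) _ _ DQ); auto.
  intros s Hs; destruct (Hne s Hs) as (N1 & N2 & N3).
  rewrite (Hq s Hs); field; auto.
- apply (antideriv_reparam J tpar _ HJ Dt Hpos)
    with (2 := deriv_on_scal _ (m / r) _ _ DZ); auto.
  intros s Hs; destruct (Hne s Hs) as (N1 & N2 & N3).
  rewrite (Hq s Hs), (Hsin s Hs); field; auto.
- intros u (s & -> & Hs); rewrite !(Hq s Hs), (E s Hs).
  f_equal; rewrite Hm; field; repeat split; auto; lra.
Qed.

End Representations.

(** * The isometry and the proof of the theorem *)

(** In the frame [e1], [e2], [d] this is the linear map that multiplies the second coordinate by
    [eps], then applies the plane rotation taking [(u, v)] to [(r, 0)]. By linearity, preserving
    lengths suffices. *)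
Lemma frame_isometry (e1 e2 d : E3) (u v eps r : R) :
  (forall w, dot w e1 ^ 2 + dot w e2 ^ 2 + dot w d ^ 2 = dot w w) ->
  eps ^ 2 = 1 -> u ^ 2 + v ^ 2 = r ^ 2 -> r <> 0 ->
  isometry (fun w => mkE3 (/ r * (u * dot w e1 + v * (eps * dot w e2)))
                          (/ r * (u * (eps * dot w e2) - v * dot w e1))
                          (dot w d)).
Proof.
intros He Heps Huv Hr a b; unfold dist3, norm; f_equal.
set (w := mkE3 (x1 a - x1 b) (x2 a - x2 b) (x3 a - x3 b)).
assert (Hlin : forall e, dot w e = dot a e - dot b e).
{ intros e; unfold w, dot; simpl; ring. }
rewrite <- (He w), !Hlin.
unfold dot at 1; simpl x1; simpl x2; simpl x3.
assert (Hu : u ^ 2 = r ^ 2 - v ^ 2) by lra.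
field_simplify_eq; [ ring [Heps Hu] | exact Hr ].
Qed.

Theorem theorem3p3 (J : R -> Prop) (psi : R -> E3) (kappa : R -> R)
    (N : R -> E3) (phi n m : R)
    (HJ : is_interval J)
    (HC4 : curve_C 4 J psi)
    (Hunit : unit_speed J psi)
    (HkN : curvature_normal J psi kappa N)
    (Hslant : slant J N phi)
    (Hn : n = cos phi)
    (Hn01 : 0 < Rabs n < 1)
    (Hm : m = n / sqrt (1 - n ^ 2)) :
  exists (F : E3 -> E3) (theta : R -> R),
    isometry F /\
    antideriv J kappa theta /\
    (forall s, J s -> Rabs (m * theta s) < 1) /\
    (* natural representation *)
    (exists A B P Q Z : R -> R,
       antideriv J (fun s => kappa s * cos (1 / n * asin (m * theta s))) A /\
       antideriv J (fun s => kappa s * sin (1 / n * asin (m * theta s))) B /\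
       antideriv J A P /\
       antideriv J B Q /\
       antideriv J theta Z /\
       forall s, J s ->
         F (psi s) = mkE3 (n / m * P s) (n / m * Q s) (n * Z s)) /\
    (* parameter theta *)
    (exists sigma : R -> R,
       reparam J theta sigma /\
       let K := image_dir theta J in
       exists A B P Q Z : R -> R,
         antideriv K (fun u => cos (1 / n * asin (m * u))) A /\
         antideriv K (fun u => sin (1 / n * asin (m * u))) B /\
         antideriv K (fun u => 1 / kappa (sigma u) * A u) P /\
         antideriv K (fun u => 1 / kappa (sigma u) * B u) Q /\
         antideriv K (fun u => u / kappa (sigma u)) Z /\
         forall u, K u ->
           F (psi (sigma u)) = mkE3 (n / m * P u) (n / m * Q u) (n * Z u)) /\
    (* parameter t = (1/n) arcsin (m theta) *)
    (let tpar := fun s => 1 / n * asin (m * theta s) in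
     exists sigma : R -> R,
       reparam J tpar sigma /\
       let K := image_dir tpar J in
       exists A B P Q Z : R -> R,
         antideriv K (fun t => cos t * cos (n * t)) A /\
         antideriv K (fun t => sin t * cos (n * t)) B /\
         antideriv K (fun t => cos (n * t) / kappa (sigma t) * A t) P /\
         antideriv K (fun t => cos (n * t) / kappa (sigma t) * B t) Q /\
         antideriv K
           (fun t => sin (n * t) * cos (n * t) / kappa (sigma t)) Z /\
         forall t, K t ->
           F (psi (sigma t)) =
             mkE3 (n ^ 3 / m ^ 3 * P t) (n ^ 3 / m ^ 3 * Q t)
                  (n ^ 2 / m ^ 2 * Z t)).
Proof.
destruct HkN as (T & T' & HT & HT' & Hk).
destruct Hslant as (d & Hd & HNd).
assert (Hkpos : forall s, J s -> 0 < kappa s) by (intros s Hs; apply Hk, Hs).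
assert (Hspeed : forall s, J s -> dot (T s) (T s) = 1).
{ destruct Hunit as (T0 & HT0 & H1); intros s Hs.
  rewrite <- (vderiv_on_unique _ _ _ _ HJ HT0 HT s Hs), <- norm_sqr, (H1 s Hs).
  ring. }
assert (Hcurv : forall s, J s -> dot (T' s) (T' s) = kappa s ^ 2).
{ intros s Hs; rewrite <- norm_sqr; f_equal; symmetry; apply Hk, Hs. }
assert (Haxis : forall s, J s -> dot (T' s) d = n * kappa s).
{ intros s Hs; destruct (Hk s Hs) as (_ & Hks & HN).
  rewrite Hn, <- (HNd s Hs), HN, dot_scal; field; lra. }
assert (Hd1 : dot d d = 1) by (rewrite <- norm_sqr, Hd; ring).
destruct (orthonormal_completion d Hd1) as (e1 & e2 & He).
(* A third derivative of [psi] is required to differentiate the principal normal. *)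
assert (HT'' : exists T'', vderiv_on J T' T'').
{ destruct HC4 as (C1 & C2 & C3), HT as (A1 & A2 & A3), HT' as (B1 & B2 & B3).
  destruct (second_derivative_differentiable _ _ _ _ HJ C1 A1 B1) as (f1 & D1).
  destruct (second_derivative_differentiable _ _ _ _ HJ C2 A2 B2) as (f2 & D2).
  destruct (second_derivative_differentiable _ _ _ _ HJ C3 A3 B3) as (f3 & D3).
  exists (fun s => mkE3 (f1 s) (f2 s) (f3 s)); repeat split; assumption. }
destruct HT'' as (T'' & HT'').
assert (Hn0 : n <> 0) by (intros ->; rewrite Rabs_R0 in Hn01; lra).
assert (Hn2 : 0 < 1 - n ^ 2).
{ rewrite <- pow2_abs; nra. }
set (r := sqrt (1 - n ^ 2)) in Hm.
assert (Hr : 0 < r) by (apply sqrt_lt_R0, Hn2).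
assert (Hr2 : r ^ 2 = 1 - n ^ 2) by (apply pow2_sqrt; lra).
set (th := fun s => / n * dot (T s) d).
assert (Hth : deriv_on J th kappa).
{ apply deriv_on_div_const with (2 := Haxis); [ exact Hn0 | ].
  apply vderiv_on_dot, HT'. }
(* Differentiability of [kappa] comes from [kappa = <T', d> / n], which avoids differentiating the
   norm. *)
assert (Dkappa : deriv_on J kappa (fun s => / n * dot (T'' s) d)).
{ apply deriv_on_ext with
    (3 := deriv_on_scal _ (/ n) _ _ (vderiv_on_dot _ _ _ d HT'')); auto.
  intros s Hs; rewrite (Haxis s Hs); field; exact Hn0. }
assert (Dnormal : forall e, exists p', deriv_on J (fun s => dot (T' s) e / kappa s) p').
{ intros e; eexists; apply deriv_onI; intros s Hs.
  apply deriv_at_div; [ exact (vderiv_on_dot _ _ _ e HT'' s Hs)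
    | exact (Dkappa s Hs) | apply Rgt_not_eq, Hkpos, Hs | exact Hs ]. }
destruct (Dnormal e1) as (p' & Hp'), (Dnormal e2) as (q' & Hq').
assert (Dtangent : forall e, deriv_on J (fun s => dot (T s) e)
                               (fun s => kappa s * (dot (T' s) e / kappa s))).
{ intros e; apply deriv_on_ext with (3 := vderiv_on_dot _ _ _ e HT'); auto.
  intros s Hs; field; apply Rgt_not_eq, Hkpos, Hs. }
assert (HTsqr : forall s, J s ->
  dot (T s) e1 ^ 2 + dot (T s) e2 ^ 2 + n ^ 2 * th s ^ 2 = 1).
{ intros s Hs; rewrite <- (Hspeed s Hs), <- He; unfold th; field; exact Hn0. }
(* The frame identity for [T'], divided by [kappa ^ 2]: the axial part takes [n ^ 2] out of 1. *)
assert (HNsqr : forall s, J s ->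
  (dot (T' s) e1 / kappa s) ^ 2 + (dot (T' s) e2 / kappa s) ^ 2 = r ^ 2).
{ intros s Hs; assert (Hks := Hkpos s Hs).
  assert (E := He (T' s)); rewrite (Hcurv s Hs), (Haxis s Hs) in E.
  rewrite Hr2; apply Rmult_eq_reg_l with (kappa s ^ 2); [ | nra ].
  field_simplify; lra. }
assert (Hlt : forall s, J s -> -1 < m * th s < 1).
{ intros s Hs.
  apply (beta_asin J _ _ th kappa _ _ p' q' n m r HJ Hr Hr2 Hm Hkpos
           (Dtangent e1) (Dtangent e2) Hth Hp' Hq' HTsqr HNsqr s Hs). }
destruct (normal_angle J _ _ th kappa _ _ p' q' n m r HJ Hn01 Hr Hr2 Hm Hkpos
            (Dtangent e1) (Dtangent e2) Hth Hp' Hq' HTsqr HNsqr)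
  as (u & v & eps & Heps & Huv & Hangle).
set (F := fun w => mkE3 (/ r * (u * dot w e1 + v * (eps * dot w e2)))
                        (/ r * (u * (eps * dot w e2) - v * dot w e1))
                        (dot w d)).
(* [F] is linear, so [A] and [B] are the first two coordinates of [F (T s)] divided by [r]; this
   fixes the inner constants of integration. *)
set (A := fun s => / r ^ 2 * (u * dot (T s) e1 + (v * eps) * dot (T s) e2)).
set (B := fun s => / r ^ 2 * ((u * eps) * dot (T s) e2 + (- v) * dot (T s) e1)).
assert (HA : deriv_on J A (fun s => kappa s * cos (1 / n * asin (m * th s)))).
{ apply deriv_on_ext with
    (3 := deriv_on_scal _ (/ r ^ 2) _ _ (deriv_on_plus _ _ _ _ _
            (deriv_on_scal _ u _ _ (Dtangent e1))
            (deriv_on_scal _ (v * eps) _ _ (Dtangent e2)))); auto.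
  intros s Hs; destruct (Hangle s Hs) as [E1 E2]; unfold tparam in E1, E2.
  (* Taking the scalar product of [(u, v)] with its image under rotation by [t] leaves
     [(u ^ 2 + v ^ 2) cos t]. *)
  transitivity (/ r ^ 2 * kappa s * (u * (dot (T' s) e1 / kappa s) +
                  v * (eps * (dot (T' s) e2 / kappa s)))); [ ring | ].
  rewrite E1, E2.
  transitivity (/ r ^ 2 * (u ^ 2 + v ^ 2) * kappa s *
                 cos (1 / n * asin (m * th s))); [ ring | ].
  rewrite Huv; field; lra. }
assert (HB : deriv_on J B (fun s => kappa s * sin (1 / n * asin (m * th s)))).
{ apply deriv_on_ext with
    (3 := deriv_on_scal _ (/ r ^ 2) _ _ (deriv_on_plus _ _ _ _ _
            (deriv_on_scal _ (u * eps) _ _ (Dtangent e2))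
            (deriv_on_scal _ (- v) _ _ (Dtangent e1)))); auto.
  intros s Hs; destruct (Hangle s Hs) as [E1 E2]; unfold tparam in E1, E2.
  transitivity (/ r ^ 2 * kappa s * (u * (eps * (dot (T' s) e2 / kappa s)) -
                  v * (dot (T' s) e1 / kappa s))); [ ring | ].
  rewrite E1, E2.
  transitivity (/ r ^ 2 * (u ^ 2 + v ^ 2) * kappa s *
                 sin (1 / n * asin (m * th s))); [ ring | ].
  rewrite Huv; field; lra. }
assert (HF1 : deriv_on J (fun s => x1 (F (psi s))) (fun s => r * A s)).
{ apply deriv_on_ext with
    (3 := deriv_on_scal _ (/ r) _ _ (deriv_on_plus _ _ _ _ _
            (deriv_on_scal _ u _ _ (vderiv_on_dot _ _ _ e1 HT))
            (deriv_on_scal _ (v * eps) _ _ (vderiv_on_dot _ _ _ e2 HT))));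
    intros s _; unfold A; simpl; [ ring | field; lra ]. }
assert (HF2 : deriv_on J (fun s => x2 (F (psi s))) (fun s => r * B s)).
{ apply deriv_on_ext with
    (3 := deriv_on_scal _ (/ r) _ _ (deriv_on_plus _ _ _ _ _
            (deriv_on_scal _ (u * eps) _ _ (vderiv_on_dot _ _ _ e2 HT))
            (deriv_on_scal _ (- v) _ _ (vderiv_on_dot _ _ _ e1 HT))));
    intros s _; unfold B; simpl; [ ring | field; lra ]. }
assert (HF3 : deriv_on J (fun s => x3 (F (psi s))) (fun s => n * th s)).
{ apply deriv_on_ext with (3 := vderiv_on_dot _ _ _ d HT); auto.
  intros s _; unfold th; field; exact Hn0. }
exists F, th.
split; [ apply frame_isometry; auto; lra | ].
split; [ exact Hth | ].
split; [ intros s Hs; apply Rabs_def1; apply Hlt, Hs | ].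
split; [ | split ].
- apply (natural_representation J th kappa A B (fun s => F (psi s)) n m r);
    assumption.
- apply (theta_representation J th kappa A B (fun s => F (psi s)) n m r);
    assumption.
- apply (t_representation J th kappa A B (fun s => F (psi s)) n m r);
    assumption.
Qed.
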